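(* Let $N\geqslant 1$ and let $\mathcal D$ be the set of all $X\in\mathcal C(\mathbb R^N)$ such that $|p_L X|=1$ for some non-zero linear subspace $L\subset\mathbb R^N$. Then $\mathcal D$ is closed and nowhere dense in $\mathcal C(\mathbb R^N)$.
   Context: A Cantor set is any topological space homeomorphic to the standard middle-thirds Cantor set. $\mathcal C(\mathbb R^N)$ is the set of all subsets of $\mathbb R^N$ that are Cantor sets, endowed with the Hausdorff metric $d_H(X,Y)=\inf\{\varepsilon>0 \mid X\subset O(Y,\varepsilon),\ Y\subset O(X,\varepsilon)\}$, where $O(X,\varepsilon)=\{y\in\mathbb R^N\mid d(y,X)<\varepsilon\}$ and $d$ is the Euclidean distance. For a linear subspace $L\subset\mathbb R^N$, $p_L$ is the orthogonal projection of $\mathbb R^N$ into $L$, and $p_L X$ is the image of $X$. $|A|$ denotes the cardinality of a set $A$. *)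

(* Defs.v *)
From HB Require Import structures.
From mathcomp Require Import all_boot all_order all_algebra.
From mathcomp Require Import all_classical all_reals all_analysis.
From mathcomp Require Import ring lra.
Import Order.TTheory GRing.Theory Num.Theory.
Import numFieldNormedType.Exports.

Set Implicit Arguments.
Unset Strict Implicit.
Unset Printing Implicit Defensive.

Local Open Scope classical_set_scope.
Local Open Scope ring_scope.

Definition homeomorphic (S T : topologicalType) : Prop :=
  exists (f : S -> T) (g : T -> S),
    [/\ cancel f g, cancel g f, continuous f & continuous g].

Section middle_thirds.
Context {R : realType}.

Fixpoint middle_thirds_level (n : nat) : set R :=
  if n is m.+1 then
    (fun x => x / 3) @` middle_thirds_level m `|`
    (fun x => (x + 2) / 3) @` middle_thirds_level m
  else `[0, 1].

Definition middle_thirds : set R := \bigcap_n middle_thirds_level n.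

Lemma middle_thirds_level_compact n : compact (middle_thirds_level n).
Proof.
elim: n => [|n IHn] /=; first exact: segment_compact.
apply: compactU; apply: continuous_compact => //;
  apply: continuous_subspaceT => x.
- by apply: cvgM; [exact: cvg_id|exact: cvg_cst].
- apply: cvgM; last exact: cvg_cst.
  by apply: cvgD; [exact: cvg_id|exact: cvg_cst].
Qed.

Lemma middle_thirds_compact : compact middle_thirds.
Proof.
apply: (subclosed_compact _ (@middle_thirds_level_compact 0%N)).
- apply: closed_bigI => n _.
  exact: (compact_closed (@Rhausdorff R) (@middle_thirds_level_compact n)).
- by move=> x /(_ 0%N I).
Qed.

Lemma middle_thirds0 : middle_thirds 0.
Proof.
move=> n _; elim: n => [|n IHn] /=; first by rewrite in_itv/= lexx ler01.
by left; exists 0 => //; rewrite mul0r.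
Qed.

End middle_thirds.
Arguments middle_thirds : clear implicits.

(* A set used as a type carries the subspace topology. *)
Definition is_cantor_set (R : realType) (T : topologicalType) (X : set T) :=
  homeomorphic X (middle_thirds R).

Section is_cantor_set_theory.
Context (R : realType) (T : topologicalType) (X : set T).
Hypothesis cX : is_cantor_set R X.

Lemma is_cantor_set_nonempty : X !=set0.
Proof.
have [_ [g _]] := cX.
have := g (SigSub (mem_set (@middle_thirds0 R))).
by case=> x /set_mem Xx; exists x.
Qed.

Lemma is_cantor_set_compact : compact X.
Proof.
have [x0 _] := is_cantor_set_nonempty.
have [f [g [fK gK _ gc]]] := cX.
pose h := valL_ x0 (set_val \o g).
have hE (y : middle_thirds R) : h (set_val y) = set_val (g y).
  by rewrite /h -[RHS]/((set_val \o g) y) -[in RHS](valLK x0 (set_val \o g)).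
have -> : X = h @` middle_thirds R.
  apply/seteqP; split=> [x Xx|_ [y Cy <-]].
    exists (set_val (f (SigSub (mem_set Xx)))); first exact: set_valP.
    by rewrite hE fK.
  have -> : y = set_val (SigSub (mem_set Cy) : middle_thirds R) by [].
  by rewrite hE; exact: set_valP.
apply: continuous_compact; last exact: middle_thirds_compact.
apply/subspace_valL_continuousP' => y.
apply: continuous_comp; first exact: gc.
exact: initial_continuous.
Qed.

End is_cantor_set_theory.

Section euclidean.
Context {R : realType} {N : nat}.
Implicit Types (u v x y z : 'rV[R]_N) (X Y : set 'rV[R]_N).

Definition dotv u v : R := \sum_i u 0 i * v 0 i.

(* The library norm on 'rV[R]_N is the sup norm, hence this one. *)
Definition enorm u : R := Num.sqrt (dotv u u).

Definition edist x y : R := enorm (x - y).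

Lemma dotvC u v : dotv u v = dotv v u.
Proof. by apply: eq_bigr => i _; rewrite mulrC. Qed.

Lemma dotvDl u v x : dotv (u + v) x = dotv u x + dotv v x.
Proof. by rewrite -big_split; apply: eq_bigr => i _; rewrite !mxE mulrDl. Qed.

Lemma dotvZl a u x : dotv (a *: u) x = a * dotv u x.
Proof. by rewrite mulr_sumr; apply: eq_bigr => i _; rewrite !mxE mulrA. Qed.

Lemma dotvNl u x : dotv (- u) x = - dotv u x.
Proof. by rewrite -scaleN1r dotvZl mulN1r. Qed.

Lemma dotvDr u v x : dotv x (u + v) = dotv x u + dotv x v.
Proof. by rewrite !(dotvC x) dotvDl. Qed.

Lemma dotvZr a u x : dotv x (a *: u) = a * dotv x u.
Proof. by rewrite !(dotvC x) dotvZl. Qed.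

Lemma dotvNr u x : dotv x (- u) = - dotv x u.
Proof. by rewrite !(dotvC x) dotvNl. Qed.

Lemma dotv_suml (I : Type) (r : seq I) (P : pred I) (F : I -> 'rV[R]_N) x :
  dotv (\sum_(i <- r | P i) F i) x = \sum_(i <- r | P i) dotv (F i) x.
Proof.
apply: (big_morph (fun u => dotv u x)); first by move=> u v; rewrite dotvDl.
by rewrite -(scale0r 0) dotvZl mul0r.
Qed.

Lemma dotv_ge0 u : 0 <= dotv u u.
Proof. by apply: sumr_ge0 => i _; rewrite -expr2 sqr_ge0. Qed.

Lemma dotv_eq0 u : dotv u u = 0 -> u = 0.
Proof.
move/eqP; rewrite psumr_eq0; last by move=> i _; rewrite -expr2 sqr_ge0.
move/allP => u0; apply/rowP => i; rewrite mxE; apply/eqP.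
by have := u0 i (mem_index_enum i); rewrite -expr2 sqrf_eq0.
Qed.

Lemma dotv_CauchySchwarz u v : dotv u v ^+ 2 <= dotv u u * dotv v v.
Proof.
have [v0|v0] := eqVneq (dotv v v) 0.
  by rewrite (dotv_eq0 v0) -(scale0r 0) !dotvZr !mul0r expr0n mulr0.
have vgt0 : 0 < dotv v v by rewrite lt_def v0 dotv_ge0.
have := dotv_ge0 (dotv v v *: u - dotv u v *: v).
rewrite !(dotvDl, dotvDr, dotvNl, dotvNr, dotvZl, dotvZr) (dotvC v u).
rewrite (_ : _ + _ = dotv v v * (dotv u u * dotv v v - dotv u v ^+ 2)).
  by rewrite pmulr_rge0// subr_ge0.
by ring.
Qed.

Lemma enorm_ge0 u : 0 <= enorm u.
Proof. exact: sqrtr_ge0. Qed.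

Lemma enorm_sqr u : enorm u ^+ 2 = dotv u u.
Proof. by rewrite sqr_sqrtr// dotv_ge0. Qed.

Lemma enorm_triangle u v : enorm (u + v) <= enorm u + enorm v.
Proof.
rewrite -(@ler_pXn2r _ 2)// ?nnegrE ?addr_ge0 ?enorm_ge0//.
rewrite sqrrD !enorm_sqr dotvDl !dotvDr (dotvC v u).
suff : dotv u v <= enorm u * enorm v by lra.
rewrite (le_trans (ler_norm _))// -(@ler_pXn2r _ 2)//.
  by rewrite real_normK ?num_real// exprMn !enorm_sqr dotv_CauchySchwarz.
by rewrite nnegrE mulr_ge0 ?enorm_ge0.
Qed.

Lemma ler_coord_enorm u i : `|u 0 i| <= enorm u.
Proof.
rewrite -sqrtr_sqr ler_sqrt ?dotv_ge0// /dotv (bigD1 i)//= expr2 lerDl.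
by apply: sumr_ge0 => j _; rewrite -expr2 sqr_ge0.
Qed.

Lemma edistxx x : edist x x = 0.
Proof. by rewrite /edist subrr /enorm -(scale0r 0) dotvZl mul0r sqrtr0. Qed.

Lemma edist_sym x y : edist x y = edist y x.
Proof. by rewrite /edist -opprB /enorm dotvNl dotvNr opprK. Qed.

Lemma edist_triangle y x z : edist x z <= edist x y + edist y z.
Proof. by rewrite /edist -(subrKA y) enorm_triangle. Qed.

(* Meaningful only for nonempty X, as inf set0 = 0. *)
Definition point_dist y X : R := inf [set edist y x | x in X].

Definition O_nbhd X (e : R) : set 'rV[R]_N := [set y | point_dist y X < e].

Definition hausdorff_dist X Y : R :=
  inf [set e : R | [/\ 0 < e, X `<=` O_nbhd Y e & Y `<=` O_nbhd X e]].

Lemma O_nbhdP X e y : X !=set0 ->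
  O_nbhd X e y <-> exists2 x, X x & edist y x < e.
Proof.
move=> [x0 Xx0]; split=> [|[x Xx yx]].
  move/inf_lt => [|_ [x Xx <-] xe]; last by exists x.
  by exists (edist y x0), x0.
apply: le_lt_trans yx; apply: ge_inf; last by exists x.
by exists 0 => _ [z _ <-]; exact: enorm_ge0.
Qed.

Let hset X Y := [set e : R | [/\ 0 < e, X `<=` O_nbhd Y e & Y `<=` O_nbhd X e]].

Lemma hausdorff_dist_sym X Y : hausdorff_dist X Y = hausdorff_dist Y X.
Proof.
by congr inf; apply/seteqP; split=> e [e0 XY YX]; split.
Qed.

Let hset_lb X Y : has_lbound (hset X Y).
Proof. by exists 0 => e [/ltW]. Qed.

Let enorm_bounded X : compact X -> exists M, forall x, X x -> enorm x <= M.
Proof.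
move=> /compact_bounded[M [_ /(_ (M + 1))]]; rewrite ltrDl ltr01 => /(_ erefl).
move=> XM; exists (Num.sqrt (\sum_(i < N) (M + 1) ^+ 2)) => x Xx.
rewrite ler_sqrt; last by apply: sumr_ge0 => i _; exact: sqr_ge0.
apply: ler_sum => i _; rewrite -expr2 -(real_normK (num_real (x 0 i))).
have xiM : `|x 0 i| <= M + 1.
  apply: le_trans (XM _ Xx); rewrite [leRHS]mx_normrE.
  exact: (le_bigmax _ (fun ij => `|x ij.1 ij.2|) (0, i)).
rewrite ler_pXn2r// nnegrE //; exact: le_trans xiM.
Qed.

Let hset_nonempty X Y : compact X -> compact Y -> X !=set0 -> Y !=set0 ->
  hset X Y !=set0.
Proof.
move=> /enorm_bounded[M XM] /enorm_bounded[M' YM] [x0 Xx0] [y0 Yy0].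
have dXY x y : X x -> Y y -> edist x y < M + M' + 1.
  move=> Xx Yy; apply: (@le_lt_trans _ _ (enorm x + enorm y)).
    have := enorm_triangle x (- y).
    by rewrite [enorm (- y)]/enorm dotvNl dotvNr opprK.
  by have := XM _ Xx; have := YM _ Yy; lra.
exists (M + M' + 1); split.
- exact: le_lt_trans (enorm_ge0 _) (dXY _ _ Xx0 Yy0).
- move=> x Xx; apply/O_nbhdP; first by exists y0.
  by exists y0 => //; exact: dXY.
- move=> y Yy; apply/O_nbhdP; first by exists x0.
  by exists x0 => //; rewrite edist_sym; exact: dXY.
Qed.

Lemma hausdorff_dist_lt X Y e : compact X -> compact Y -> X !=set0 -> Y !=set0 ->
  hausdorff_dist X Y < e -> X `<=` O_nbhd Y e /\ Y `<=` O_nbhd X e.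
Proof.
move=> cX cY X0 Y0 /inf_lt[|d [d0 XY YX] de]; first exact: hset_nonempty.
by split=> x => [/XY|/YX] /lt_trans; exact.
Qed.

Lemma hausdorff_dist_ge0 X Y : compact X -> compact Y ->
  X !=set0 -> Y !=set0 -> 0 <= hausdorff_dist X Y.
Proof.
move=> cX cY X0 Y0; apply: lb_le_inf; first exact: hset_nonempty.
by move=> e [/ltW].
Qed.

Lemma hausdorff_distxx X : X !=set0 -> compact X -> hausdorff_dist X X = 0.
Proof.
move=> X0 cX; apply/eqP; rewrite eq_le hausdorff_dist_ge0// andbT.
apply/ler_addgt0Pr => e e0; rewrite add0r; apply: ge_inf; first exact: hset_lb.
have XX : X `<=` O_nbhd X e.
  by move=> x Xx; apply/O_nbhdP => //; exists x => //; rewrite edistxx.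
by split.
Qed.

Lemma hausdorff_dist_triangle Y X Z : compact X -> compact Y -> compact Z ->
  X !=set0 -> Y !=set0 -> Z !=set0 ->
  hausdorff_dist X Z <= hausdorff_dist X Y + hausdorff_dist Y Z.
Proof.
move=> cX cY cZ X0 Y0 Z0; apply/ler_addgt0Pr => e e0.
have [a [a0 XY YX] ae] :
    exists2 d, hset X Y d & d < hausdorff_dist X Y + e / 2.
  by apply: inf_lt; [exact: hset_nonempty|rewrite ltrDl divr_gt0].
have [b [b0 YZ ZY] be] :
    exists2 d, hset Y Z d & d < hausdorff_dist Y Z + e / 2.
  by apply: inf_lt; [exact: hset_nonempty|rewrite ltrDl divr_gt0].
apply: (@le_trans _ _ (a + b)); last by lra.
have comp A B C c d : B !=set0 -> C !=set0 -> A `<=` O_nbhd B c ->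
    B `<=` O_nbhd C d -> A `<=` O_nbhd C (c + d).
  move=> B0 C0 AB BC x /AB/(O_nbhdP _ _ B0)[y /BC/(O_nbhdP _ _ C0)[z Cz yz] xy].
  apply/O_nbhdP => //; exists z => //.
  by rewrite (le_lt_trans (edist_triangle y _ _))// ltrD.
apply: ge_inf; first exact: hset_lb.
split; first exact: addr_gt0.
- exact: comp XY YZ.
- by rewrite addrC; exact: comp ZY YX.
Qed.

Lemma hausdorff_dist_eq0 X Y : compact X -> compact Y ->
  X !=set0 -> Y !=set0 -> hausdorff_dist X Y = 0 -> X = Y.
Proof.
suff sub A B : compact A -> compact B -> A !=set0 -> B !=set0 ->
    hausdorff_dist A B = 0 -> A `<=` B.
  move=> cX cY X0 Y0 XY; apply/seteqP; split; first exact: sub XY.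
  by apply: sub => //; rewrite hausdorff_dist_sym.
move=> cA cB A0 B0 AB x Ax.
have clB : closed B by apply: compact_closed => //; exact: norm_hausdorff.
apply: clB => U /nbhs_ballP[e /= e0 xeU].
have [|+ _] := @hausdorff_dist_lt A B e cA cB A0 B0; first by rewrite AB.
move=> /(_ _ Ax)/(O_nbhdP _ _ B0)[y By xy].
exists y; split => //; apply: xeU; split => // i j.
rewrite (ord1 i) /ball/=; apply: le_lt_trans xy.
by have := ler_coord_enorm (x - y) j; rewrite !mxE.
Qed.

End euclidean.

Section orthogonal_projection.
Context {R : realType} {N : nat}.
Implicit Types (L : {vspace 'rV[R]_N}) (x y z : 'rV[R]_N).

(* The point of L such that x - y is orthogonal to L; orth_projP proves that
   it exists and orth_proj_uniq that it is unique. *)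
Definition orth_proj L x : 'rV[R]_N :=
  xget 0 [set y | y \in L /\ forall z, z \in L -> dotv (x - y) z = 0].

Lemma orth_projP L x :
  orth_proj L x \in L /\ forall z, z \in L -> dotv (x - orth_proj L x) z = 0.
Proof.
apply: (@xgetPex _ 0 [set y | y \in L /\ forall z, z \in L -> dotv (x - y) z = 0]).
pose b i := (vbasis L)`_i.
pose lc (u : 'rV[R]_(\dim L)) := \sum_i u 0 i *: b i.
have lcL u : lc u \in L.
  apply: memv_suml => i _; apply: memvZ; apply: vbasis_mem; apply: mem_nth.
  by rewrite size_tuple.
pose G : 'M[R]_(\dim L) := \matrix_(i, j) dotv (b i) (b j).
have uG u j : (u *m G) 0 j = dotv (lc u) (b j).
  by rewrite mxE dotv_suml; apply: eq_bigr => i _; rewrite dotvZl mxE.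
have dotlc y u : dotv y (lc u) = \sum_j u 0 j * dotv y (b j).
  rewrite dotvC dotv_suml; apply: eq_bigr => j _.
  by rewrite dotvZl dotvC.
have Gunit : G \in unitmx.
  rewrite -row_free_unit; apply/inj_row_free => u uG0.
  have lcu0 : lc u = 0.
    apply: dotv_eq0; rewrite dotlc big1// => j _.
    by rewrite -uG uG0 mxE mulr0.
  apply/rowP => i; rewrite mxE.
  have /freeP := basis_free (vbasisP L).
  by move/(_ (fun i => u 0 i)); apply; exact: lcu0.
pose c := (\row_j dotv x (b j)) *m invmx G.
exists (lc c); split; first exact: lcL.
move=> z zL; rewrite (coord_vbasis zL).
pose w := \row_i coord (vbasis L) i z.
have -> : \sum_(i < \dim L) coord (vbasis L) i z *: (vbasis L)`_i = lc w.
  by apply: eq_bigr => i _; rewrite mxE.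
rewrite dotlc big1// => j _; rewrite dotvDl dotvNl -uG mulmxKV// [X in _ - X]mxE subrr.
by rewrite mulr0.
Qed.

Lemma orth_proj_uniq L x y :
  y \in L -> (forall z, z \in L -> dotv (x - y) z = 0) -> y = orth_proj L x.
Proof.
move=> yL xy; have [pL xp] := orth_projP L x.
have dL : y - orth_proj L x \in L by rewrite memvB.
apply/eqP; rewrite -subr_eq0; apply/eqP/dotv_eq0.
have {1}-> : y - orth_proj L x = (x - orth_proj L x) - (x - y).
  by rewrite opprB [RHS]addrC subrKA.
by rewrite dotvDl dotvNl xp// xy// subrr.
Qed.

End orthogonal_projection.

Record cantor_subset (R : realType) (N : nat) := CantorSubset {
  cantor_subset_set :> set 'rV[R]_N ;
  cantor_subsetP : is_cantor_set R cantor_subset_set }.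

HB.instance Definition _ R N := gen_eqMixin (cantor_subset R N).
HB.instance Definition _ R N := gen_choiceMixin (cantor_subset R N).

Section cantor_subset_metric.
Context {R : realType} {N : nat}.
Implicit Types X Y Z : cantor_subset R N.

Let cpt X := is_cantor_set_compact (cantor_subsetP X).
Let nonempty X := is_cantor_set_nonempty (cantor_subsetP X).

Let distxx X : hausdorff_dist X X = 0.
Proof. exact: hausdorff_distxx. Qed.

Let dist_positivity X Y : hausdorff_dist X Y = 0 -> X = Y.
Proof.
move=> /(hausdorff_dist_eq0 (@cpt X) (@cpt Y) (nonempty X) (nonempty Y)).
case: X Y => [X cX] [Y cY] /= XY; subst Y.
by congr CantorSubset; exact: Prop_irrelevance.
Qed.

Let dist_sym X Y : hausdorff_dist X Y = hausdorff_dist Y X.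
Proof. exact: hausdorff_dist_sym. Qed.

Let dist_triangle Y X Z :
  hausdorff_dist X Z <= hausdorff_dist X Y + hausdorff_dist Y Z.
Proof. exact: hausdorff_dist_triangle. Qed.

HB.instance Definition _ := isMetric.Build R (cantor_subset R N)
  distxx dist_positivity dist_sym dist_triangle.

End cantor_subset_metric.

Definition nowhere_dense (T : topologicalType) (A : set T) : Prop :=
  (closure A)° = set0.

Definition degenerate_cantor_subsets (R : realType) (N : nat) :
    set (cantor_subset R N) :=
  [set X | exists2 L : {vspace 'rV[R]_N},
     L != 0%VS & (orth_proj L @` X #= `I_1)%card].

(* Main.v *)
(* X is degenerate iff it lies in an affine hyperplane: a line orthogonal to
   the hyperplane serves as L.  If X lies in none, then it contains points
   p0, p1, ..., pm whose differences pk - p0 span the space; spanning is an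
   open condition on the points, and every Cantor set close to X has points
   close to the pk, so the non-degenerate Cantor sets form an open set.
   For density of the complement, some coordinate i takes infinitely many
   values on X.  The map x |-> x + e m(x_i), where m is a curve of monomials
   that meets each hyperplane in finitely many points, is a homeomorphism of
   the whole space, moves X by O(e), and maps X into a hyperplane for at most
   finitely many e > 0. *)
Require Import Defs.
From mathcomp Require Import all_boot all_order all_algebra.
From mathcomp Require Import all_classical all_reals all_analysis.
From mathcomp Require Import ring lra.
Import Order.TTheory GRing.Theory Num.Theory.
Import numFieldNormedType.Exports.

Set Implicit Arguments.
Unset Strict Implicit.
Unset Printing Implicit Defensive.

Local Open Scope classical_set_scope.
Local Open Scope ring_scope.


(** * Affine hyperplanes and the rank of difference matrices *)

Lemma row_full_mulmx_unit (F : fieldType) m n (B : 'M[F]_(n, m))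
    (A : 'M[F]_(m, n)) :
  B *m A \in unitmx -> row_full A.
Proof.
move=> uBA; apply/row_fullP; exists (invmx (B *m A) *m B).
by rewrite -mulmxA mulVmx.
Qed.

Section affine_degeneracy.
Context {R : realType} {N : nat} {T : Type}.
Implicit Types (g : T -> 'rV[R]_N) (X : set T).

(** Keeping the map [g] apart from [X] lets one notion serve for a Cantor set ([g = id]), for the
    moment curve over a set of reals, and for sheared points. *)
Definition in_hyperplane g X : Prop :=
  exists2 v : 'rV[R]_N, v != 0 &
    forall x y, X x -> X y -> dotv (g x) v = dotv (g y) v.

Definition diff_mx g m (p0 : T) (p : 'I_m -> T) : 'M[R]_(m, N) :=
  \matrix_k (g (p k) - g p0).

Lemma mulmx_tr_dotv m (A : 'M[R]_(m, N)) (v : 'rV[R]_N) k :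
  (A *m v^T) k 0 = dotv (row k A) v.
Proof. by rewrite mxE; apply: eq_bigr => j _; rewrite !mxE. Qed.

Lemma row_full_not_in_hyperplane g X m p0 (p : 'I_m -> T) :
  X p0 -> (forall k, X (p k)) -> row_full (diff_mx g p0 p) ->
  ~ in_hyperplane g X.
Proof.
move=> Xp0 Xp /row_fullP[B BA] [v /eqP v0 vX]; apply: v0.
apply: trmx_inj; rewrite trmx0 -[LHS]mul1mx -BA -mulmxA.
rewrite (_ : _ *m v^T = 0) ?mulmx0//; apply/colP => k.
rewrite mulmx_tr_dotv rowK dotvDl dotvNl mxE.
by rewrite (vX _ _ (Xp k) Xp0) subrr.
Qed.

(** Points are chosen to maximise the rank. If it is still deficient, some [v != 0] is orthogonal to
    all the differences, and a further point off the hyperplane normal to [v] would raise it. *)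
Lemma not_in_hyperplane_row_full g X : X !=set0 -> ~ in_hyperplane g X ->
  exists p0 m (p : 'I_m -> T),
    [/\ X p0, forall k, X (p k) & row_full (diff_mx g p0 p)].
Proof.
move=> [p0 Xp0] ndX; exists p0.
pose P r := `[< exists m (p : 'I_m -> T),
  (forall k, X (p k)) /\ \rank (diff_mx g p0 p) = r >].
have exP : exists r, P r.
  pose p (k : 'I_0) := p0.
  by exists (\rank (diff_mx g p0 p)); apply/asboolP; exists 0%N, p.
have ubP r : P r -> (r <= N)%N.
  by move=> /asboolP[m [p [_ <-]]]; exact: rank_leq_col.
case: (ex_maxnP exP ubP) => r /asboolP[m [p [Xp rE]]] rmax.
exists m, p; split => //; apply: contrapT => /negP nfull.
have [v vA v0] : exists2 v : 'rV_N, v *m (diff_mx g p0 p)^T = 0 & v != 0.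
  apply: contrapT => noker; case/negP: nfull.
  rewrite /row_full -mxrank_tr; apply: inj_row_free => v vA.
  by apply: contrapT => /eqP v0; apply: noker; exists v.
apply: ndX; exists v => //.
have Av : diff_mx g p0 p *m v^T = 0.
  by rewrite -[LHS]trmxK trmx_mul trmxK vA trmx0.
suff dX x : X x -> dotv (g x) v = dotv (g p0) v by move=> x y /dX-> /dX->.
move=> Xx; apply/eqP; rewrite -subr_eq0 -dotvNl -dotvDl.
apply: contraT => xv.
pose p' (k : 'I_(m + 1)) := if fintype.split k is inl j then p j else x.
have p'E : diff_mx g p0 p' = col_mx (diff_mx g p0 p) (g x - g p0).
  apply/matrixP => k j; rewrite !mxE /p'.
  by case: (fintype.split k) => l; rewrite ?mxE ?(ord1 l).
have /rmax : P (\rank (diff_mx g p0 p')).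
  apply/asboolP; exists (m + 1)%N, p'; split => // k.
  by rewrite /p'; case: (fintype.split k).
rewrite leqNgt -rE => /negP[]; apply: rank_ltmx.
rewrite p'E /ltmx -!addsmxE; apply/andP; split; first exact: addsmxSl.
(* A new row in the row space of the old matrix would be orthogonal to [v], like the old rows. *)
apply: contra xv; rewrite addsmx_sub => /andP[_ /submxP[D xE]].
have := mulmx_tr_dotv (g x - g p0) v 0.
rewrite row_id => <-.
by rewrite xE -mulmxA Av mulmx0 mxE.
Qed.

End affine_degeneracy.

(** * Degeneracy as containment in an affine hyperplane *)

Section degenerate_cantor_subsets.
Context {R : realType} {N : nat}.

Lemma degenerate_cantor_subsetsP (X : cantor_subset R N) :
  degenerate_cantor_subsets X <-> in_hyperplane id X.
Proof.
have [x0 Xx0] := is_cantor_set_nonempty (cantor_subsetP X).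
split=> [[L L0 /eq_cardSP[y _ +]]|[v v0 vX]].
  (* Removing [y] from the image leaves nothing, so the projection is constantly [y] on [X]. *)
  rewrite II0 card_eq0 => /eqP Ly.
  have LX x : (X : set _) x -> orth_proj L x = y.
    move=> Xx; apply: contrapT => xy.
    suff : set0 (orth_proj L x) by [].
    by rewrite -Ly; split => //; exists x.
  exists (vpick L); first by rewrite vpick0.
  suff dE x : (X : set _) x -> dotv x (vpick L) = dotv y (vpick L).
    by move=> x z /dE-> /dE->.
  move=> Xx; have [_ /(_ _ (memv_pick L))] := orth_projP L x.
  by rewrite LX// dotvDl dotvNl => /eqP; rewrite subr_eq0 => /eqP.
exists <[v]>%VS; first by rewrite -subv0 -memvE memv0.
have -> : orth_proj <[v]> @` X = [set orth_proj <[v]> x0].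
  apply/seteqP; split=> [_ [x Xx <-]|_ ->]; last by exists x0.
  have [pL p0] := orth_projP <[v]> x0.
  (* The projection of [x0] meets the condition that characterises the projection of [x], since
     [x - x0] is orthogonal to [v]. *)
  apply/esym/orth_proj_uniq => // z vz; rewrite -(p0 _ vz).
  have /vlineP[a ->] := vz.
  by rewrite !dotvDl !dotvZr (vX _ _ Xx Xx0).
exact: card_set1.
Qed.

End degenerate_cantor_subsets.

(** * Stability of full rank, homeomorphic images, infinitude of Cantor sets *)

Section topology.
Context {R : realType}.

Lemma continuous_mul (T : topologicalType) (f g : T -> R) :
  continuous f -> continuous g -> continuous (fun x => f x * g x).
Proof. by move=> fc gc x; apply: cvgM; [exact: fc|exact: gc]. Qed.

Lemma continuous_add (T : topologicalType) (f g : T -> R) :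
  continuous f -> continuous g -> continuous (fun x => f x + g x).
Proof. by move=> fc gc x; apply: cvgD; [exact: fc|exact: gc]. Qed.

Lemma mulmx_entry_continuous m n p (B : 'M[R]_(m, n)) i j :
  continuous (fun A : 'M[R]_(n, p) => (B *m A) i j).
Proof.
have -> : (fun A : 'M[R]_(n, p) => (B *m A) i j) =
    (fun A => \sum_k B i k * A k j).
  by apply/funext => A; rewrite mxE.
apply: (continuous_big (@add_continuous _)) => k _.
apply: continuous_mul; [exact: cst_continuous|exact: coord_continuous].
Qed.

Lemma det_mulmx_continuous m n (B : 'M[R]_(m, n)) :
  continuous (fun A : 'M[R]_(n, m) => \det (B *m A)).
Proof.
apply: (continuous_big (@add_continuous _)) => s _.
apply: continuous_mul; first exact: cst_continuous.
apply: (continuous_big (@mul_continuous _)) => i _.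
exact: mulmx_entry_continuous.
Qed.

(** A left inverse [B] of [A] is fixed: [\det (B *m A')] is continuous in [A'] and equals 1 at
    [A]. *)
Lemma row_full_near m n (A : 'M[R]_(m, n)) : row_full A ->
  exists2 e : R, 0 < e &
    forall A' : 'M[R]_(m, n), (forall i j, `|A i j - A' i j| < e) -> row_full A'.
Proof.
move=> /row_fullP[B BA].
have : \forall A' \near A, \det (B *m A') != 0.
  have BA0 : \det (B *m A) != 0 by rewrite BA det1 oner_neq0.
  exact: (cvgr_neq0 _ (@det_mulmx_continuous _ _ B A) BA0).
move=> /nbhs_ballP[e /= e0 Be]; exists e => // A' AA'.
by apply: (@row_full_mulmx_unit _ _ _ B); rewrite unitmxE unitfE; exact: Be.
Qed.

Lemma rV_continuous (U : topologicalType) n (f : U -> 'rV[R]_n) :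
  (forall i, continuous (fun x => f x 0 i)) -> continuous f.
Proof.
move=> fc x A [B Bf BA].
have : \forall y \near x, forall i, B 0 i (f y 0 i).
  by apply: filter_forall => i; apply: fc; exact: Bf.
by apply: filterS => y yB; apply: BA => i j; rewrite ord1; exact: yB.
Qed.

Lemma homeomorphic_trans (S T U : topologicalType) :
  homeomorphic S T -> homeomorphic T U -> homeomorphic S U.
Proof.
move=> [f [f' [fK f'K fc f'c]]] [g [g' [gK g'K gc g'c]]].
exists (g \o f), (f' \o g'); split; [exact: can_comp|exact: can_comp| |].
- by move=> x; apply: continuous_comp; [exact: fc|exact: gc].
- by move=> x; apply: continuous_comp; [exact: g'c|exact: f'c].
Qed.

Lemma homeomorphic_image (T : topologicalType) (h k : T -> T) (X : set T) :
  cancel h k -> continuous h -> continuous k -> homeomorphic (h @` X) X.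
Proof.
move=> hK hc kc.
have kX (y : h @` X) : k (set_val y) \in X.
  by have [x Xx xy] := set_valP y; rewrite -[set_val y]xy hK inE.
have hX (x : X) : h (set_val x) \in h @` X.
  by rewrite inE; exists (set_val x) => //; exact: set_valP.
exists (fun y => SigSub (kX y)), (fun x => SigSub (hX x)); split.
- move=> y; apply: val_inj => /=.
  by have [x Xx xy] := set_valP y; rewrite -[LHS]/(h (k (set_val y))) -[set_val y]xy hK.
- by move=> x; apply: val_inj => /=; rewrite hK.
- apply: continuous_comp_initial => y.
  apply: (@continuous_comp _ _ _ set_val k); last exact: kc.
  exact: initial_continuous.
- apply: continuous_comp_initial => x.
  apply: (@continuous_comp _ _ _ set_val h); last exact: hc.
  exact: initial_continuous.
Qed.

Lemma is_cantor_set_image (T : topologicalType) (h k : T -> T) (X : set T) :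
  cancel h k -> continuous h -> continuous k ->
  is_cantor_set R X -> is_cantor_set R (h @` X).
Proof.
by move=> hK hc kc; apply: homeomorphic_trans; exact: homeomorphic_image hK _ _.
Qed.

(** Supplies infinitely many explicit points. The point 1 is fixed by the right-hand contraction,
    and the left-hand one sends each power to the next. *)
Lemma middle_thirds_exprV n : middle_thirds R (3^-1 ^+ n).
Proof.
move=> k _; elim: k n => [|k IHk] [|n] /=.
- by rewrite expr0 in_itv/= ler01 lexx.
- by rewrite in_itv/= exprn_ge0// exprn_ile1// invf_le1// ler1n.
- right; exists 1; first exact: (IHk 0%N).
  by rewrite expr0 -[1]/(1%:R) -natrD divff// pnatr_eq0.
- by left; exists (3^-1 ^+ n); [exact: IHk|rewrite exprSr].
Qed.

Lemma is_cantor_set_infinite (T : topologicalType) (X : set T) :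
  is_cantor_set R X -> infinite_set X.
Proof.
move=> [f [g [_ gK _ _]]] finX.
pose c n : middle_thirds R := SigSub (mem_set (middle_thirds_exprV n)).
have c_inj : injective c.
  move=> m n /(congr1 val)/=; apply: ieexprIn; first by rewrite invr_gt0.
  by rewrite invr_eq1 -[1]/(1%:R) eqr_nat.
pose u n : T := set_val (g (c n)).
have uX : range u `<=` X by move=> _ [n _ <-]; exact: set_valP.
have u_inj : injective u by move=> m n /val_inj/(can_inj gK)/c_inj.
apply: infinite_nat; apply: (@sub_finite_set _ _ (u @^-1` X)).
  by move=> n _; apply: uX; exists n.
by apply: finite_preimage => // m n _ _; exact: u_inj.
Qed.

(** If every coordinate took finitely many values, the points would be encoded by functions from
    ['I_N] to one finite set. *)
Lemma infinite_coordinate N (X : set 'rV[R]_N) : infinite_set X ->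
  exists i, infinite_set [set x 0 i | x in X].
Proof.
move=> infX; apply: contrapT => nX; apply: infX.
have : finite_set (\bigcup_(i in [set: 'I_N]) [set x 0 i | x in X]).
  apply: bigcup_finite => // i _; apply: contrapT => infi.
  by apply: nX; exists i.
move=> /finite_seqP[s sE].
pose r (f : {ffun 'I_N -> seq_sub s}) : 'rV[R]_N := \row_i val (f i).
apply: (@sub_finite_set _ _ (range r)); last exact/finite_image/finite_finset.
move=> x Xx.
have xs i : x 0 i \in s.
  suff : [set` s] (x 0 i) by [].
  by rewrite -sE; exists i => //; exists x.
exists [ffun i => SeqSub (xs i)] => //.
by apply/rowP => i; rewrite mxE ffunE.
Qed.

End topology.

(** * Closedness *)

Section closedness.
Context {R : realType} {N : nat}.

Lemma closed_degenerate_cantor_subsets :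
  closed (@degenerate_cantor_subsets R N).
Proof.
move=> X clX; apply: contrapT => /degenerate_cantor_subsetsP ndX.
have X0 := is_cantor_set_nonempty (cantor_subsetP X).
have [p0 [m [p [Xp0 Xp]]]] := not_in_hyperplane_row_full X0 ndX.
move=> /row_full_near[e e0 near_full].
(* Each row of the difference matrix involves two points; moving both by less than [e / 2] changes
   its entries by less than [e]. *)
have e20 : 0 < e / 2 by rewrite divr_gt0.
have [Y [/degenerate_cantor_subsetsP dY XY]] := clX _ (nbhsx_ballx X _ e20).
have Y0 := is_cantor_set_nonempty (cantor_subsetP Y).
have [subXY _] := hausdorff_dist_lt (is_cantor_set_compact (cantor_subsetP X))
  (is_cantor_set_compact (cantor_subsetP Y)) X0 Y0 XY.
have ptY x : (X : set _) x -> exists y, (Y : set _) y /\ Defs.edist x y < e / 2.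
  by move=> /subXY/(O_nbhdP _ _ Y0)[y Yy xy]; exists y.
have [q0 [Yq0 pq0]] := ptY _ Xp0.
have /choice[q pq] k := ptY _ (Xp k).
have {}Yq k : (Y : set _) (q k) by have [] := pq k.
have {}pq k : Defs.edist (p k) (q k) < e / 2 by have [] := pq k.
apply: row_full_not_in_hyperplane Yq0 Yq _ dY; apply: near_full => k j.
rewrite !mxE (_ : _ - _ = (p k - q k) 0 j - (p0 - q0) 0 j); last first.
  by rewrite !mxE; ring.
rewrite (le_lt_trans (ler_normB _ _))// [ltRHS]splitr.
by apply: ltrD; apply: le_lt_trans (ler_coord_enorm _ _) _;
  [exact: pq|exact: pq0].
Qed.

End closedness.

(** * Full rank for arbitrarily small parameters of a matrix pencil *)

Section generic_perturbation.
Context {R : realFieldType}.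

Lemma finite_roots (p : {poly R}) : p != 0 -> finite_set [set t | root p t].
Proof.
move=> p0; apply: contrapT => /(infinite_set_fset (size p))[B Bp].
rewrite leqNgt => /negP; apply; apply: (max_poly_roots p0).
  by apply/allP => t tB; exact: (Bp t).
exact: finmap.fset_uniq.
Qed.

Lemma nonroot_lt (p : {poly R}) (d : R) : p != 0 -> 0 < d ->
  exists2 e, 0 < e < d & ~~ root p e.
Proof.
move=> p0 d0; apply: contrapT => noe.
(* The shift by two keeps every value strictly below [d]. *)
pose r k := d / k.+2%:R.
have r0d k : 0 < r k < d.
  by rewrite divr_gt0//= ltr_pdivrMr// ltr_pMr// ltr1n.
have r_inj : injective r.
  move=> k l /(mulfI (lt0r_neq0 d0))/invr_inj/eqP.
  by rewrite eqr_nat => /eqP[].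
apply: infinite_nat.
apply: (@sub_finite_set _ _ (r @^-1` [set t | root p t])).
  by move=> k _; apply: contrapT => /negP rk; apply: noe; exists (r k).
by apply: finite_preimage (finite_roots p0) => k l _ _; exact: r_inj.
Qed.

(* A left inverse B of V turns the bad parameters e into eigenvalues of -BA. *)
Lemma row_full_perturbation m n (A V : 'M[R]_(m, n)) (d : R) :
  row_full V -> 0 < d -> exists2 e, 0 < e < d & row_full (A + e *: V)%R.
Proof.
move=> /row_fullP[B BV] d0.
have char0 : char_poly (- (B *m A)) != 0.
  by rewrite monic_neq0// char_poly_monic.
have [e e0d /negP e_eig] := nonroot_lt char0 d0; exists e => //.
have BAV : B *m (A + e *: V) = B *m A + e%:M.
  by rewrite mulmxDr -scalemxAr BV scalemx1.
apply: (@row_full_mulmx_unit _ _ _ B).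
rewrite -row_free_unit; apply: inj_row_free => v /eqP.
rewrite BAV mulmxDr mul_mx_scalar addr_eq0 => /eqP vBA.
apply: contrapT => /eqP v0; apply: e_eig.
rewrite -eigenvalue_root_char; apply/eigenvalueP; exists v => //.
by rewrite mulmxN vBA opprK.
Qed.

End generic_perturbation.

Lemma in_hyperplane_image (R : realType) N (S T : Type) (f : S -> T)
    (g : T -> 'rV[R]_N) (X : set S) :
  in_hyperplane g (f @` X) <-> in_hyperplane (g \o f) X.
Proof.
split=> -[v v0 vX]; exists v => //.
  by move=> x y Xx Xy; apply: vX; [exists x|exists y].
by move=> _ _ [x Xx <-] [y Xy <-]; exact: vX.
Qed.

(** * The moment curve and the shear along it *)

Section moment_shear.
Context {R : realType} {N : nat}.
Variable i : 'I_N.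

(* The exponents are distinct and nonzero, so that 1 and the monomials of the
   curve are independent; the exponent 1 in direction i makes shear, which
   multiplies the coordinate i by 1 + e, explicitly invertible. *)
Definition moment_exponent (j : 'I_N) : nat := if j == i then 1 else j.+2.

Lemma moment_exponent_inj : injective moment_exponent.
Proof.
move=> j k; rewrite /moment_exponent.
by case: eqP => [->|_]; case: eqP => [->|_]// [/val_inj].
Qed.

Lemma moment_exponent_gt0 j : (0 < moment_exponent j)%N.
Proof. by rewrite /moment_exponent; case: eqP. Qed.

Definition moment_curve (t : R) : 'rV[R]_N :=
  \row_j t ^+ moment_exponent j.

Definition shear (e : R) (x : 'rV[R]_N) : 'rV[R]_N :=
  x + e *: moment_curve (x 0 i).

Definition shear_inv (e : R) (y : 'rV[R]_N) : 'rV[R]_N :=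
  y - e *: moment_curve (y 0 i / (1 + e)).

(** A hyperplane with normal [v] yields a polynomial vanishing on [S] whose coefficients include the
    entries of [v]; being nonzero, it has only finitely many roots. *)
Lemma moment_curve_not_in_hyperplane (S : set R) :
  infinite_set S -> ~ in_hyperplane moment_curve S.
Proof.
move=> infS [v v0 vS].
have [t0 St0] := infinite_setN0 infS.
pose q := \sum_j v 0 j *: 'X^(moment_exponent j)
          - (dotv (moment_curve t0) v)%:P.
have qE t : q.[t] = dotv (moment_curve t) v - dotv (moment_curve t0) v.
  rewrite hornerD hornerN hornerC horner_sum; congr (_ - _).
  by apply: eq_bigr => j _; rewrite hornerZ hornerXn mxE mulrC.
have q_coef j : q`_(moment_exponent j) = v 0 j.
  (* The constant term does not interfere because the exponents are positive. *)
  rewrite coefB coefC gtn_eqF ?moment_exponent_gt0// subr0 coef_sum.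
  rewrite (bigD1 j)//= coefZ coefXn eqxx mulr1 big1 ?addr0// => k kj.
  by rewrite coefZ coefXn (inj_eq moment_exponent_inj) eq_sym (negPf kj) mulr0.
have q0 : q != 0.
  apply: contra v0 => /eqP q0; apply/eqP/rowP => j.
  by rewrite -q_coef q0 coef0 mxE.
apply: infS; apply: sub_finite_set (finite_roots q0) => t St /=.
by rewrite rootE qE (vS _ _ St St0) subrr.
Qed.

Lemma moment_curve_continuous : continuous moment_curve.
Proof.
apply: rV_continuous => j.
under eq_fun do rewrite mxE.
exact: exprn_continuous.
Qed.

(** Common form of [shear] ([s] the identity) and [shear_inv] ([s] the division by [1 + e], with
    [- e] in place of [e]). *)
Lemma continuous_add_moment (s : R -> R) (e : R) : continuous s ->
  continuous (fun x : 'rV[R]_N => x + e *: moment_curve (s (x 0 i))).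
Proof.
move=> sc; apply: rV_continuous => j.
under eq_fun do rewrite !mxE.
apply: continuous_add; first exact: coord_continuous.
apply: continuous_mul; first exact: cst_continuous.
move=> x.
apply: (@continuous_comp _ _ _ (fun x : 'rV[R]_N => s (x 0 i)) (fun t => t ^+ _));
  last exact: exprn_continuous.
apply: (@continuous_comp _ _ _ (fun x : 'rV[R]_N => x 0 i) s); last exact: sc.
exact: coord_continuous.
Qed.

Lemma shear_continuous e : continuous (shear e).
Proof. by apply: (@continuous_add_moment id) => x; exact: cvg_id. Qed.

Lemma shear_inv_continuous e : continuous (shear_inv e).
Proof.
rewrite (_ : shear_inv e = fun x : 'rV[R]_N =>
  x + (- e) *: moment_curve (x 0 i / (1 + e))); last first.
  by apply/funext => x; rewrite scaleNr.
apply: (@continuous_add_moment (fun t => t / (1 + e))).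
by apply: continuous_mul; [move=> t; exact: cvg_id|exact: cst_continuous].
Qed.

Lemma shearK e : 0 < e -> cancel (shear e) (shear_inv e).
Proof.
move=> e0 x; rewrite /shear_inv (_ : _ / _ = x 0 i) ?addrK//.
rewrite !mxE /moment_exponent eqxx expr1 -[X in X + _]mul1r -mulrDl.
by rewrite mulrAC mulfV ?mul1r// lt0r_neq0// addr_gt0.
Qed.

(** Brings the differences of sheared points into the form [A + e *: V] of
    [row_full_perturbation]. *)
Lemma diff_mx_shear e m p0 (p : 'I_m -> _) :
  diff_mx (shear e) p0 p =
  diff_mx id p0 p + e *: diff_mx (fun x => moment_curve (x 0 i)) p0 p.
Proof. by apply/matrixP => k j; rewrite !mxE; ring. Qed.

Lemma enorm_moment_bounded (X : set 'rV[R]_N) : compact X ->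
  exists2 M, 0 < M & forall x, X x -> enorm (moment_curve (x 0 i)) <= M.
Proof.
move=> cX.
pose s (x : 'rV[R]_N) := dotv (moment_curve (x 0 i)) (moment_curve (x 0 i)).
have sc : continuous s.
  have mc j : continuous (fun x : 'rV[R]_N => moment_curve (x 0 i) 0 j).
    move=> x.
    apply: (@continuous_comp _ _ _ (fun x : 'rV[R]_N => moment_curve (x 0 i))
      (fun u : 'rV[R]_N => u 0 j)); last exact: coord_continuous.
    apply: (@continuous_comp _ _ _ (fun x : 'rV[R]_N => x 0 i) moment_curve).
      exact: coord_continuous.
    exact: moment_curve_continuous.
  by apply: (continuous_big (@add_continuous _)) => j _; exact: continuous_mul.
have /compact_bounded[M [_ /(_ (M + 1))]] : compact (s @` X).
  by apply: continuous_compact cX; exact: continuous_subspaceT.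
rewrite ltrDl ltr01 => /(_ erefl) sM.
have sM' x : X x -> s x <= `|M + 1|.
  move=> Xx; apply: le_trans (ler_norm _) _; apply: le_trans (ler_norm _).
  by apply: sM; exists x.
(* From [u ^+ 2 <= K] follows [u <= 1 + K], which avoids a square root. *)
exists (1 + `|M + 1|); first by rewrite ltr_pwDl.
move=> x /sM'; rewrite /s -enorm_sqr.
have := enorm_ge0 (moment_curve (x 0 i)).
by set u := enorm _ => u0 uM; nra.
Qed.

End moment_shear.

(** * Density of the non-degenerate Cantor sets *)

Lemma enormZ (R : realType) N (e : R) (u : 'rV[R]_N) :
  enorm (e *: u) = `|e| * enorm u.
Proof.
rewrite /enorm dotvZl dotvZr mulrA -expr2 sqrtrM ?sqr_ge0//.
by rewrite sqrtr_sqr.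
Qed.

Lemma hausdorff_dist_image_le (R : realType) N (h : 'rV[R]_N -> 'rV[R]_N)
    (X : set 'rV[R]_N) (d : R) : X !=set0 -> 0 < d ->
  (forall x, X x -> enorm (h x - x) < d) -> hausdorff_dist X (h @` X) <= d.
Proof.
move=> [x0 Xx0] d0 hd; apply: ge_inf; first by exists 0 => e [/ltW].
split=> // [x Xx|_ [x Xx <-]]; apply/O_nbhdP.
- by exists (h x0), x0.
- by exists (h x); [exists x|rewrite Defs.edist_sym; exact: hd].
- by exists x0.
- by exists x => //; exact: hd.
Qed.

Lemma degenerate_cantor_subset_approx (R : realType) N (X : cantor_subset R N)
    (d : R) : 0 < d ->
  exists2 Y : cantor_subset R N, hausdorff_dist X Y < d &
    ~ degenerate_cantor_subsets Y.
Proof.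
move=> d0; have cX := cantor_subsetP X.
have [i infXi] := infinite_coordinate (is_cantor_set_infinite cX).
have X0 := is_cantor_set_nonempty cX.
have [M M0 XM] := enorm_moment_bounded i (is_cantor_set_compact cX).
have /(not_in_hyperplane_row_full X0)[p0 [m [p [Xp0 Xp full]]]] :
    ~ in_hyperplane (fun x : 'rV[R]_N => moment_curve i (x 0 i)) X.
  move=> /(in_hyperplane_image (fun x : 'rV[R]_N => x 0 i)).
  exact: moment_curve_not_in_hyperplane.
(* The shear moves a point of [X] by at most [e * M], hence by less than [d / 2]; the halving makes
   the final bound on the Hausdorff distance strict. *)
have d2M0 : 0 < d / 2 / M by rewrite !divr_gt0.
have [e /andP[e0 ed] efull] :=
  row_full_perturbation (diff_mx id p0 p) full d2M0.
exists (CantorSubset (is_cantor_set_image (shearK i e0)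
  (@shear_continuous _ _ i e) (@shear_inv_continuous _ _ i e) cX)) => /=.
  apply: (@le_lt_trans _ _ (d / 2)); last by lra.
  apply: hausdorff_dist_image_le => // [|x Xx]; first by rewrite divr_gt0.
  rewrite /shear addrC addKr enormZ gtr0_norm//.
  rewrite ltr_pdivlMr// in ed; apply: le_lt_trans ed.
  by rewrite ler_pM2l// XM.
(* The hyperplane is pulled back along the shear, so the points [p0] and [p] of [X] itself refute
   it. *)
move=> /degenerate_cantor_subsetsP/= /in_hyperplane_image.
apply: row_full_not_in_hyperplane Xp0 Xp _.
by rewrite diff_mx_shear.
Qed.

Theorem mainTheorem4 (R : realType) (N : nat) (N_ge1 : (1 <= N)%N) :
  closed (@degenerate_cantor_subsets R N) /\
  nowhere_dense (@degenerate_cantor_subsets R N).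
Proof.
have clD := @closed_degenerate_cantor_subsets R N; split=> //.
(* As the set is its own closure, it is enough that no ball lies inside it. *)
rewrite /nowhere_dense -(closure_id _).1//; apply/seteqP; split=> // X.
move=> /nbhs_ballP[d /= d0 XD].
have [Y XY] := degenerate_cantor_subset_approx X d0; apply; exact: XD.
Qed.
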